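(* Suppose $f$ is a $C^2$ function on a closed manifold $M$. Then the number of critical points of $f$ satisfies $$|\mathrm{Crit} f|\ \ge\ \mathrm{cat}^{a}(M),$$ where $\mathrm{cat}^{a}(M)$ is the ambient Lusternik-Schnirelmann category of $M$.
   Context: Manifolds are smooth; closed means compact without boundary. $\mathrm{Crit} f$ is the set of critical points of $f:M\to\mathbb{R}$. A subset $A\subset M$ of a manifold is called ambient nullhomotopic if there is a differentiable map $h_1:M\to M$, homotopic through differentiable maps $M\to M$ to the identity $h_0=\mathrm{id}_M$, such that $h_1(a)=m$ for all $a\in A$, for some point $m\in M$. The ambient Lusternik-Schnirelmann category $\mathrm{cat}^{a}(M)$ of a non-empty manifold $M$ is the least integer $\ell\in\mathbb{N}$ such that there is a cover $U_1,\dots,U_\ell$ of $M$ by $\ell$ open ambient nullhomotopic subsets; if there is no such finite cover, $\mathrm{cat}^{a}(M):=\infty$; and the empty set has category $0$. *)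

(* Defs.v *)
From HB Require Import structures.
From mathcomp Require Import all_boot all_order all_algebra.
From mathcomp Require Import all_classical all_reals all_analysis.

Set Implicit Arguments.
Unset Strict Implicit.
Unset Printing Implicit Defensive.

Import Order.TTheory GRing.Theory Num.Theory.
Import numFieldNormedType.Exports.

Local Open Scope classical_set_scope.
Local Open Scope ring_scope.

(* [f] is of class C^k on the open set [U]; the values of [f] outside [U] are
   irrelevant. In finite dimension, asking all directional derivatives to be of
   class C^(k-1) is the same as asking it of x |-> 'd f x. *)
Fixpoint Ck (R : realType) (V W : normedModType R) (k : nat) (U : set V)
    (f : V -> W) : Prop :=
  if k is k'.+1 then
    (forall x, U x -> differentiable f x) /\
    (forall v, Ck k' U (fun x => 'D_v f x))
  else forall x, U x -> {for x, continuous f}.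

Definition Cinfty (R : realType) (V W : normedModType R) (U : set V)
    (f : V -> W) : Prop := forall k, Ck k U f.

(* A homeomorphism from an open subset [dom] of [M] onto an open subset of
   R^n. [chart_map] and [chart_inv] are total functions whose values outside
   [dom], resp. outside the image of [dom], are arbitrary. *)
Record chart (R : realType) (n : nat) (M : topologicalType) := Chart {
  dom : set M;
  chart_map : M -> 'rV[R]_n;
  chart_inv : 'rV[R]_n -> M;
  dom_open : open dom;
  cod_open : open (chart_map @` dom);
  chart_mapK : {in dom, cancel chart_map chart_inv};
  chart_map_cont : forall p, dom p -> {for p, continuous chart_map};
  chart_inv_cont :
    forall x, (chart_map @` dom) x -> {for x, continuous chart_inv} }.

Definition cod (R : realType) (n : nat) (M : topologicalType)
  (c : chart R n M) : set 'rV[R]_n := chart_map c @` dom c.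

(* The atlas is not required to be maximal. No point is assumed to exist, so
   the empty manifold is included. *)
Record manifold (R : realType) (n : nat) := Manifold {
  carrier :> topologicalType;
  manifold_hausdorff : hausdorff_space carrier;
  manifold_second_countable : @second_countable carrier;
  atlas : set (chart R n carrier);
  atlas_cover : forall p, exists2 c, atlas c & dom c p;
  atlas_smooth : forall c d, atlas c -> atlas d ->
    Cinfty (chart_map c @` (dom c `&` dom d)) (chart_map d \o chart_inv c) }.

Definition closed_manifold (R : realType) (n : nat) (M : manifold R n) : Prop :=
  compact [set: M].

Section Manifold.
Context (R : realType) (n : nat) (M : manifold R n).

Definition Ck_function (k : nat) (f : M -> R) : Prop :=
  forall c, atlas c -> Ck k (cod c) (f \o chart_inv c).

Definition critical (f : M -> R) (p : M) : Prop :=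
  forall c, atlas c -> dom c p ->
    forall v, 'd (f \o chart_inv c) (chart_map c p) v = 0.

Definition Crit (f : M -> R) : set M := [set p | critical f p].

Definition differentiable_map (h : M -> M) : Prop :=
  continuous h /\
  forall (p : M) c d, atlas c -> atlas d -> dom c p -> dom d (h p) ->
    differentiable (chart_map d \o h \o chart_inv c) (chart_map c p).

(* Only each h_t is required to be differentiable; jointly in (t, p) the
   homotopy is continuous. *)
Definition homotopic_through_differentiable (h0 h1 : M -> M) : Prop :=
  exists h : R -> M -> M,
    [/\ {within `[0, 1]%classic `*` [set: M],
           continuous (fun z : R * M => h z.1 z.2)},
        forall t, 0 <= t <= 1 -> differentiable_map (h t),
        h 0 = h0 & h 1 = h1].

Definition ambient_nullhomotopic (A : set M) : Prop :=
  exists h1 : M -> M,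
    [/\ differentiable_map h1,
        homotopic_through_differentiable idfun h1 &
        exists m : M, forall a, A a -> h1 a = m].

Definition ambient_cover (l : nat) : Prop :=
  exists U : 'I_l -> set M,
    (forall i, open (U i) /\ ambient_nullhomotopic (U i)) /\
    \bigcup_i U i = [set: M].

(* For empty [M] this is 0, attained by the cover with no members. *)
Definition cat_a : \bar R :=
  match pselect (exists l, `[< ambient_cover l >]) with
  | left e => (ex_minn e)%:R%:E
  | right _ => +oo%E
  end.

End Manifold.

(* Main.v *)
Require Import Defs.
From mathcomp Require Import all_boot all_order all_algebra.
From mathcomp Require Import all_classical all_reals all_analysis.
From mathcomp Require Import lra.

(** No flow is needed: descent is done by finitely many explicit steps. Near a
    noncritical point [p] pick, in a chart, a vector [w] with [D_w f < 0], and
    translate by a small bump function times [w]. This is a differentiable map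
    homotopic to the identity which fixes every point outside the support of the
    bump and strictly lowers [f] inside it. Composing finitely many such maps
    lowers [f] strictly on any compact set of noncritical points.
    Similarly, translating by [x0 - x] times a bump function collapses a
    neighbourhood of any point.

    Say that a level [a] is covered if [{f <= a}] is covered by ambient
    nullhomotopic open sets [U p] indexed by the critical points [p] with
    [f p <= a]. If [b] were the infimum of the levels which are not covered, let
    [W] be the union of small ambient nullhomotopic neighbourhoods of the
    critical points at level [b]. Some descent map [h] sends
    [{f <= b + e} \ W] into [{f <= b - e}], so the preimages under [h] of a
    cover of [{f <= b - e}], together with the neighbourhoods of the critical
    points at level [b], cover all the levels up to [b + e]: a contradiction. *)

Set Implicit Arguments.
Unset Strict Implicit.
Unset Printing Implicit Defensive.

Import Order.TTheory GRing.Theory Num.Theory.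
Import numFieldNormedType.Exports.

Local Open Scope classical_set_scope.
Local Open Scope ring_scope.

(** * Locality of continuity and differentiability *)

Lemma near_eq_continuous (T U : topologicalType) (f g : T -> U) (x : T) :
  {near x, f =1 g} -> {for x, continuous f} -> {for x, continuous g}.
Proof.
move=> fg cf; rewrite /prop_for /continuous_at -(nbhs_singleton fg).
apply: cvg_trans cf; apply: near_eq_cvg.
by apply: filterS fg => y ->.
Qed.

Lemma near_eq_differentiable (R : realFieldType) (V W : normedModType R)
    (f g : V -> W) (x : V) :
  {near x, f =1 g} -> differentiable f x -> differentiable g x.
Proof.
move=> fg df; have fgx := nbhs_singleton fg.
have eg : g \o shift x = cst (g x) + 'd f x +o_ 0 id.
  apply/eqaddoP => e e0.
  have /eqaddoP/(_ e e0) := diff_locally df.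
  apply: filter_app.
  have {}fg : \forall y \near (0 : V), f (y + x) = g (y + x).
    by have := fg; rewrite (near_shift 0 x) subr0.
  by apply: filterS fg => y; rewrite !fctE /= fgx => <-.
have dg : 'd g x = 'd f x :> (V -> W)
  by apply: diff_unique eg; exact: diff_continuous.
by apply/diff_locallyP; rewrite dg; split => //; exact: diff_continuous.
Qed.

(** * Differentiable bump functions on R^n *)

Section Bump.
Context (R : realType).

(** Squaring removes the kink at 0: the values there are bounded by the square of [y], so the linear
    part is zero. One derivative suffices, since [differentiable_map] asks for no more. *)
Lemma differentiable_sqr_pospart (x : R) :
  differentiable (fun y : R => Num.max y 0 ^+ 2) x.
Proof.
have [x0|x0|->] := ltgtP x 0.
- apply: (@near_eq_differentiable R R R (cst 0)); last first.
    exact: differentiable_cst.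
  by near=> y; rewrite /= max_r ?expr0n// ltW//; near: y; exact: lt_nbhsl.
- apply: (@near_eq_differentiable R R R (id ^+ 2)); last first.
    by apply: differentiableX.
  by near=> y; rewrite /= max_l// ltW//; near: y; exact: lt_nbhsr.
pose f (y : R) := Num.max y 0 ^+ 2; pose z : R -> R := cst 0.
have dz : 'd z 0 = 0 :> (R -> R) by exact: diff_cst.
have E : f \o shift 0 = cst (f 0) + 'd z 0 +o_ 0 id.
  apply/eqaddoP => e e0; rewrite dz; near=> y.
  rewrite /f !fctE /= !addr0 maxxx expr0n/= subr0 normrX expr2.
  apply: (@le_trans _ _ (`|y| * `|y|)).
    by apply: ler_pM => //; rewrite /Num.max; case: ifP => //; rewrite normr0.
  by apply: ler_wpM2r => //; near: y; exact: nbhs0_le.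
have df : 'd f 0 = 'd z 0 :> (R -> R).
  by apply: diff_unique E; rewrite dz => y; exact: cst_continuous.
apply/diff_locallyP; rewrite df; split => //; rewrite dz => y.
exact: cst_continuous.
Unshelve. all: by end_near. Qed.

Lemma bump_exists n (x0 : 'rV[R]_n) (r : R) : 0 < r ->
  exists b : 'rV[R]_n -> R,
    [/\ forall x, differentiable b x, forall x, 0 <= b x <= 1,
        \forall x \near x0, b x = 1 & forall x, r < `|x - x0| -> b x = 0].
Proof.
move=> r0.
pose w (y : R) := Num.max y 0 ^+ 2.
pose q (x : 'rV[R]_n) := \sum_(i < n) (x ord0 i - x0 ord0 i) ^+ 2.
(* With [q] the squared Euclidean distance to [x0], [v] is 2 at [x0] and nonpositive once [q x]
   reaches [r ^+ 2]. *)
pose v (x : 'rV[R]_n) := 2 - q x * (2 / r ^+ 2).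
have w0 y : y <= 0 -> w y = 0 by move=> y0; rewrite /w max_r// expr0n.
have w1 y : 1 <= y -> 1 <= w y by move=> y1; rewrite /w max_l ?expr_ge1//; lra.
have wge0 y : 0 <= w y by rewrite /w sqr_ge0.
have wle1 y : y <= 1 -> w y <= 1.
  move=> y1; rewrite /w expr_le1// ?le_max ?lexx ?orbT// ge_max y1/=; lra.
have dq x : differentiable q x.
  have -> : q =
      \sum_(i < n) (fun x : 'rV[R]_n => (x ord0 i - x0 ord0 i)) ^+ 2.
    by apply/funext => y; rewrite /q fct_sumE;
      apply: eq_bigr => i _; rewrite fctE.
  apply: differentiable_sum => i; apply: differentiableX.
  apply: differentiableB; first exact: differentiable_coord.
  exact: differentiable_cst.
have dv x : differentiable v x.
  apply: differentiableB; first exact: differentiable_cst.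
  by apply: differentiableM => //; exact: differentiable_cst.
have dw x : differentiable w x by exact: differentiable_sqr_pospart.
(* [w] vanishes on nonpositive numbers and is at least 1 from 1 on, so the value is exactly 1 where
   [v x >= 1] and exactly 0 where [v x <= 0]. *)
exists (fun x => 1 - w (1 - w (v x))); split.
- move=> x; apply: differentiableB; first exact: differentiable_cst.
  apply: (@differentiable_comp _ _ _ _ (fun x => 1 - w (v x)) w) => //.
  apply: differentiableB; first exact: differentiable_cst.
  exact: differentiable_comp.
- move=> x; rewrite subr_ge0 gerBl wge0 andbT wle1//.
  by rewrite gerBl.
- have : \forall x \near x0, 1 < v x.
    have : {for x0, continuous v} by exact: differentiable_continuous.
    move=> /cvgr_gt; apply.
    by rewrite /v /q big1 ?mul0r ?subr0 ?ltr1n// => i _; rewrite subrr expr0n.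
  apply: filterS => x v1; rewrite [X in 1 - X]w0 ?subr0//.
  by rewrite subr_le0 w1// ltW.
- move=> x xr; suff v0 : v x <= 0.
    by rewrite (w0 (v x))// subr0 /w max_l// expr1n subrr.
  (* The norm is the max norm: some coordinate attains it, and its square is one of the terms of
     [q x]. *)
  have [[i j] xij] : exists ij, `|x - x0| = `|(x - x0) ij.1 ij.2|.
    by apply: mx_norm_neq0; rewrite gt_eqF// (lt_trans r0).
  have rq : r ^+ 2 <= q x.
    rewrite /q (bigD1 j)//= -[leLHS]addr0 lerD//; last first.
      by apply: sumr_ge0 => k _; exact: sqr_ge0.
    rewrite -[leRHS]real_normK ?num_real// lerXn2r ?nnegrE ?(ltW r0)//.
    by move: xr; rewrite xij/= !mxE ord1 => /ltW.
  rewrite subr_le0 mulrCA ler_peMr// ler_pdivlMr ?exprn_gt0//.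
  by rewrite mul1r.
Qed.
End Bump.

(** * Calculus and compact balls in R^n *)

Section RowVectors.
Context (R : realType) (n : nat).

Lemma differentiable_row (V : normedModType R) (F : V -> 'rV[R]_n) (x : V) :
  (forall j, differentiable (fun y => F y ord0 j) x) -> differentiable F x.
Proof.
move=> dF; have -> : F = \sum_j (fun y => F y ord0 j *: delta_mx ord0 j).
  by apply/funext => y; rewrite fct_sumE [LHS]row_sum_delta.
by apply: differentiable_sum => j; exact: differentiableZl.
Qed.

Lemma compact_ball (x0 : 'rV[R]_n) (r : R) : 0 < r ->
  compact [set x | `|x - x0| <= r].
Proof.
move=> r0; apply: bounded_closed_compact.
  exists (r + `|x0|); split => [|y ry x /= xr]; first by rewrite num_real.
  rewrite -(subrK x0 x) (le_trans (ler_normD _ _))//.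
  by rewrite (le_trans _ (ltW ry))// lerD.
have -> : [set x | `|x - x0| <= r] = closed_ball x0 r;
  last exact: closed_ball_closed.
by rewrite closed_ballE//; apply/seteqP; split => x /=; rewrite distrC.
Qed.

Lemma near_closed_ball (x0 : 'rV[R]_n) (P : set 'rV[R]_n) : nbhs x0 P ->
  exists2 r, 0 < r & forall x, `|x - x0| <= r -> P x.
Proof.
move=> /nbhs_normP[r /= r0 rP]; exists (r / 2); first by rewrite divr_gt0.
move=> x xr; apply: rP; rewrite /= distrC (le_lt_trans xr)//; lra.
Qed.

Lemma derive_line (F : 'rV[R]_n -> R) (x w : 'rV[R]_n) (s : R) :
  differentiable F (s *: w + x) ->
  is_derive s 1 (fun t : R => F (t *: w + x)) ('D_w F (s *: w + x)).
Proof.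
move=> dF; have := derivableP (@diff_derivable _ _ _ F _ w dF).
have E : (fun h : R => h^-1 *: (((fun t : R => F (t *: w + x)) \o shift s)
      (h *: (1 : R)) - F (s *: w + x))) =
    (fun h : R => h^-1 *: ((F \o shift (s *: w + x)) (h *: w)
      - F (s *: w + x))).
  by apply/funext => h /=; rewrite scalerDl addrA [h *: 1]mulr1.
by move=> [dv _]; split; rewrite /derivable/derive E.
Qed.

End RowVectors.

(** * Charts, and composition of maps and homotopies *)

Section Deformation.
Context (R : realType) (n : nat) (M : manifold R n).
Implicit Types (g h : M -> M) (c d : chart R n M).

Lemma chart_map_dom c p : dom c p -> cod c (chart_map c p).
Proof. by move=> cp; exists p. Qed.

Lemma dom_nbhs c p : dom c p -> \forall q \near p, dom c q.
Proof. by move=> cp; apply: open_nbhs_nbhs; split => //; exact: dom_open. Qed.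

Lemma cod_nbhs c p : dom c p -> \forall x \near chart_map c p, cod c x.
Proof.
by move=> cp; apply: open_nbhs_nbhs; split;
  [exact: cod_open|exact: chart_map_dom].
Qed.

Lemma chart_invP c x : cod c x ->
  dom c (chart_inv c x) /\ chart_map c (chart_inv c x) = x.
Proof. by move=> [p cp <-]; rewrite chart_mapK ?inE. Qed.

Lemma differentiable_map_comp g h :
  differentiable_map g -> differentiable_map h -> differentiable_map (g \o h).
Proof.
move=> [cg dg] [ch dh]; split.
  by move=> p; apply: continuous_comp; [exact: ch|exact: cg].
move=> p c d ac ad cp dp.
(* A chart [e] at [h p] splits the composite in two; by continuity of [h] the factorisation is valid
   near [p]. *)
have [e ae ep] := atlas_cover (h p).
have cE : chart_inv c (chart_map c p) = p by rewrite chart_mapK ?inE.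
have : differentiable ((chart_map d \o g \o chart_inv e) \o
    (chart_map e \o h \o chart_inv c)) (chart_map c p).
  apply: differentiable_comp; first exact: dh.
  by rewrite /= cE; exact: dg.
apply: near_eq_differentiable.
have cont : {for chart_map c p, continuous (h \o chart_inv c)}.
  by apply: continuous_comp; [exact/chart_inv_cont/chart_map_dom|exact: ch].
have : \forall x \near chart_map c p, dom e (h (chart_inv c x)).
  by apply: cont; rewrite /= cE; exact: dom_nbhs.
by apply: filterS => x ex /=; rewrite chart_mapK ?inE.
Qed.

Lemma homotopic_idfun_comp g h :
  homotopic_through_differentiable idfun g ->
  homotopic_through_differentiable idfun h ->
  homotopic_through_differentiable idfun (g \o h).
Proof.
move=> [G [cG dG G0 G1]] [H [cH dH H0 H1]].
exists (fun t => G t \o H t); split.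
- apply/subspace_continuousP => -[t p] [/= t01 _].
  have /subspace_continuousP/(_ (t, H t p)) := cG => /(_ (conj t01 I)) Gtp.
  have /subspace_continuousP/(_ (t, p)) := cH => /(_ (conj t01 I)) Htp.
  have tH : (z.1, H z.1 z.2)
      @[z --> within (`[0, 1] `*` [set: M]) (nbhs (t, p))] --> (t, H t p).
    have ctp : z.1 @[z --> within (`[0, 1] `*` [set: M]) (nbhs (t, p))] --> t.
      by apply: cvg_within_filter; exact: cvg_fst.
    exact: (cvg_pair ctp Htp).
  apply: (cvg_comp (fun z => (z.1, H z.1 z.2)) (fun z => G z.1 z.2) _ Gtp).
  (* [(s, H s q)] stays in the strip over [[0, 1]], so [tH] is also a limit within that strip, as
     [Gtp] demands. *)
  move=> A /tH /=; rewrite /within /= /nbhs /=.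
  by apply: filterS => -[s q] /= sA [s01 _]; exact: sA.
- by move=> t t01; apply: differentiable_map_comp; [exact: dG|exact: dH].
- by rewrite G0 H0.
- by rewrite G1 H1.
Qed.

(** * Displacements supported in one chart *)

Section Push.
Variables (c : chart R n M) (u : 'rV[R]_n -> 'rV[R]_n) (K : set 'rV[R]_n).
Hypotheses (ac : atlas c) (du : forall x, differentiable u x)
  (cK : compact K) (Kc : K `<=` cod c) (uK : forall x, ~ K x -> u x = 0)
  (uc : forall t x, 0 <= t <= 1 -> cod c x -> cod c (x + t *: u x)).

(** Points move along straight segments of the chart. [uc] keeps these segments in the image of the
    chart, and [uK] makes the map the identity off the copy of [K] in [M]. *)
Definition push (t : R) (p : M) : M :=
  if `[< dom c p >] then chart_inv c (chart_map c p + t *: u (chart_map c p))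
  else p.

Lemma push_in t p : dom c p ->
  push t p = chart_inv c (chart_map c p + t *: u (chart_map c p)).
Proof. by move=> cp; rewrite /push; case: asboolP. Qed.

Lemma push_id t p : dom c p -> u (chart_map c p) = 0 -> push t p = p.
Proof.
by move=> cp u0; rewrite push_in// u0 scaler0 addr0 chart_mapK ?inE.
Qed.

(** The copy of [K] in [M] is compact, hence closed as [M] is Hausdorff; its complement is a
    neighbourhood of [p] on which nothing moves. This glues the two branches of [push]. *)
Lemma push_out p : ~ dom c p -> \forall q \near p, forall t, push t q = q.
Proof.
move=> cp.
have KM : closed (chart_inv c @` K).
  apply: compact_closed; first exact: manifold_hausdorff.
  apply: continuous_compact => //; apply: continuous_in_subspaceT => x.
  by rewrite inE => /Kc; exact: chart_inv_cont.
have Kp : ~ (chart_inv c @` K) p.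
  by move=> [x /Kc cx xp]; apply: cp; rewrite -xp; exact: (chart_invP cx).1.
have : nbhs p (~` (chart_inv c @` K)).
  by apply: open_nbhs_nbhs; split => //; exact: closed_openC.
apply: filterS => q Kq t.
have [cq|cq] := pselect (dom c q); last by rewrite /push; case: asboolP.
apply: push_id => //; apply: uK => Kcq; apply: Kq; exists (chart_map c q) => //.
by rewrite chart_mapK ?inE.
Qed.

Lemma push_dom t p : 0 <= t <= 1 -> dom c p -> dom c (push t p).
Proof.
move=> t01 cp; rewrite push_in//.
exact: (chart_invP (uc t01 (chart_map_dom cp))).1.
Qed.

Lemma push_continuous t p : 0 <= t <= 1 ->
  {for (t, p), continuous (fun z : R * M => push z.1 z.2)}.
Proof.
move=> t01; have [cp|/push_out cp] := pselect (dom c p); last first.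
  apply: (@near_eq_continuous _ _ snd); last exact: cvg_snd.
  have : \forall z \near (t, p), forall s, push s z.2 = z.2.
    exact: (cvg_snd cp).
  by apply: filterS => z ->.
apply: (@near_eq_continuous _ _ (chart_inv c \o (fun z : R * M =>
  chart_map c z.2 + z.1 *: u (chart_map c z.2)))).
  have : \forall z \near (t, p), dom c z.2.
    by apply: (@cvg_snd _ _ _ (nbhs p)); exact: dom_nbhs.
  by apply: filterS => z cz; rewrite push_in.
apply: continuous_comp; last first.
  exact/chart_inv_cont/uc/chart_map_dom.
have cc : {for (t, p), continuous (fun z : R * M => chart_map c z.2)}.
  by apply: continuous_comp; [exact: cvg_snd|exact: chart_map_cont].
have cu : {for (t, p), continuous (fun z : R * M => u (chart_map c z.2))}.
  by apply: continuous_comp => //; exact/differentiable_continuous.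
have c1 : z.1 @[z --> (t, p)] --> t by exact: cvg_fst.
exact: (cvgD cc (cvgZ c1 cu)).
Qed.

Lemma push_differentiable t : 0 <= t <= 1 -> differentiable_map (push t).
Proof.
move=> t01; split.
  move=> p.
  apply: (@continuous_comp _ _ _ (fun q => (t, q))
    (fun z : R * M => push z.1 z.2)); last exact: push_continuous.
  have ct : t @[_ --> p] --> t by exact: cvg_cst.
  exact: (cvg_pair ct (@cvg_id _ (nbhs p))).
move=> p d e ad ae dp ep.
have dE : chart_inv d (chart_map d p) = p by rewrite chart_mapK ?inE.
have dcont : {for chart_map d p, continuous (chart_inv d)}.
  exact/chart_inv_cont/chart_map_dom.
have [cp|cp] := pselect (dom c p); last first.
  have pE := push_out cp.
  have : differentiable (chart_map e \o chart_inv d) (chart_map d p).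
    have [+ _] := atlas_smooth ad ae 1%N; apply; exists p => //; split => //.
    by rewrite -(nbhs_singleton pE t).
  apply: near_eq_differentiable.
  have : \forall x \near chart_map d p,
      forall s, push s (chart_inv d x) = chart_inv d x.
    apply: (dcont [set q | forall s, push s q = q]).
    by rewrite dE.
  by apply: filterS => x /= ->.
(* Read through [c], the map is a displacement between two transition maps. *)
have : differentiable ((chart_map e \o chart_inv c) \o (fun x => x + t *: u x)
    \o (chart_map c \o chart_inv d)) (chart_map d p).
  apply: differentiable_comp.
    by have [+ _] := atlas_smooth ad ac 1%N; apply; exists p.
  rewrite /= dE; apply: differentiable_comp.
    by apply: differentiableD => //; exact: differentiableZ.
  have [+ _] := atlas_smooth ac ae 1%N; apply.
  exists (push t p); first by split => //; exact: push_dom.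
  by rewrite push_in// (chart_invP (uc t01 (chart_map_dom cp))).2.
apply: near_eq_differentiable.
have : \forall x \near chart_map d p, dom c (chart_inv d x).
  by apply: dcont; rewrite dE; exact: dom_nbhs.
by apply: filterS => x cx /=; rewrite push_in.
Qed.

Lemma push_homotopic : homotopic_through_differentiable idfun (push 1).
Proof.
exists push; split => //.
- apply: continuous_in_subspaceT => -[t p]; rewrite inE => -[/= t01 _].
  exact: push_continuous.
- exact: push_differentiable.
- apply/funext => p; rewrite /push; case: asboolP => // cp.
  by rewrite scale0r addr0 chart_mapK ?inE.
Qed.

End Push.

(** * Collapsing a neighbourhood of a point *)

Lemma ambient_nullhomotopic_nbhs p :
  exists W : set M, [/\ open W, W p & ambient_nullhomotopic W].
Proof.
have [c ac cp] := atlas_cover p; set x0 := chart_map c p.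
have [r r0 rc] : exists2 r, 0 < r & forall x, `|x - x0| <= r -> cod c x.
  exact/near_closed_ball/cod_nbhs.
have [b [db b01 b1 b0]] := bump_exists x0 r0.
pose u x := b x *: (x0 - x).
have push_hom : homotopic_through_differentiable idfun (push c u 1).
  apply: (@push_homotopic _ _ [set x | `|x - x0| <= r]) => //.
  - move=> x; apply: differentiable_row => j.
    have -> : (fun y => u y ord0 j) = b * (fun y => x0 ord0 j - y ord0 j).
      by apply/funext => y; rewrite !mxE.
    apply: differentiableM => //; apply: differentiableB => //.
    exact: differentiable_coord.
  - exact: compact_ball.
  - by move=> x /negP; rewrite -ltNge => /b0 bx; rewrite /u bx scale0r.
  - move=> t x /andP[t0 t1] cx; have [xr|/b0 bx] := leP `|x - x0| r; last first.
      by rewrite /u bx scale0r scaler0 addr0.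
    (* The factor [1 - t * b x] lies between 0 and 1, so the ball is mapped into itself. *)
    apply: rc; have -> : x + t *: u x - x0 = (1 - t * b x) *: (x - x0).
      rewrite /u scalerA scalerBl scale1r -(opprB x0 x) scalerN opprK opprB.
      by rewrite addrAC.
    have /andP[bx0 bx1] := b01 x.
    rewrite normrZ (le_trans _ xr)// ler_piMl// ler_norml; nra.
(* As [b] is 1 on a whole neighbourhood of [x0], [p] is interior to this fibre. *)
exists (push c u 1 @^-1` [set p])°; split.
- exact: open_interior.
- have : \forall q \near p, dom c q by exact: dom_nbhs.
  have : \forall q \near p, b (chart_map c q) = 1
    by exact: (chart_map_cont cp b1).
  rewrite /interior; apply: filterS2 => q bq cq.
  rewrite /= push_in// /u bq !scale1r addrC subrK /x0 chart_mapK ?inE//.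
- exists (push c u 1); split => //; last by exists p => q /interior_subset.
  by have [h [_ dh _ <-]] := push_hom; apply: dh; rewrite lexx ler01.
Qed.

(** * Maps that lower [f] *)

Section Descent.
Variable f : M -> R.
Hypothesis Cf : Ck_function 1 f.

(** Being fixed is stronger than keeping the same value: a point moved by [h] within its level could
    escape the strict descent of [g] in [g \o h]. *)
Definition descending h :=
  homotopic_through_differentiable idfun h /\
  forall p, f (h p) < f p \/ h p = p.

Lemma descending_near p : ~ critical f p ->
  exists2 h, descending h & \forall q \near p, f (h q) < f q.
Proof.
move=> ncp; have [c [ac cp [w Dw]]] : exists c, [/\ atlas c, dom c p &
    exists w, 'D_w (f \o chart_inv c) (chart_map c p) < 0].
  apply: contrapT => nex; apply: ncp => c ac cp v.
  have [df _] := Cf ac; have {}df := df _ (chart_map_dom cp).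
  (* A nonzero derivative along [v] is negative along [v] or along [- v]. *)
  apply: contrapT => /eqP; rewrite neq_lt => /orP[|] fv; apply: nex; exists c;
    split => //.
    by exists v; rewrite deriveE.
  by exists (- v); rewrite deriveE// linearN oppr_lt0.
have [df cDf] := Cf ac.
set F := f \o chart_inv c in Dw df cDf; set x0 := chart_map c p in Dw.
have [r r0 rc] : exists2 r, 0 < r &
    forall x, `|x - x0| <= r -> cod c x /\ 'D_w F x < 0.
  apply: near_closed_ball; apply: filterI; first exact: cod_nbhs.
  have : {for x0, continuous (fun x => 'D_w F x)}.
    by apply: cDf; exact: chart_map_dom.
  by move=> /cvgr_lt; apply.
(* The support of the bump and the length of the displacement get half of [r] each, so moving points
   stay in the ball where the derivative along [w] is negative. *)
have r20 : 0 < r / 2 by rewrite divr_gt0.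
have [b [db b01 b1 b0]] := bump_exists x0 r20.
have w1 : 0 < 1 + `|w| by rewrite ltr_wpDr.
have [e e0 ew] : exists2 e, 0 < e & e * `|w| <= r / 2.
  exists (r / 2 / (1 + `|w|)); first by rewrite divr_gt0.
  rewrite mulrAC ler_pdivrMr// ler_pM2l//; lra.
pose u x := (e * b x) *: w.
have ball_move x s :
    `|x - x0| <= r / 2 -> 0 <= s <= e -> `|s *: w + x - x0| <= r.
  move=> xr /andP[s0 se]; rewrite -addrA (le_trans (ler_normD _ _))// normrZ.
  have : `|s| * `|w| <= e * `|w| by rewrite ler_wpM2r// ger0_norm.
  lra.
have push_hom : homotopic_through_differentiable idfun (push c u 1).
  apply: (@push_homotopic _ _ [set x | `|x - x0| <= r / 2]) => //.
  - move=> x; apply: differentiableZl; exact: (@differentiableZ _ _ _ b e x).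
  - exact: compact_ball.
  - move=> x /= xr; apply: (rc _ _).1; lra.
  - by move=> x /negP; rewrite -ltNge => /b0 bx; rewrite /u bx mulr0 scale0r.
  - move=> t x /andP[t0 t1] cx.
    have [xr|/b0 bx] := leP `|x - x0| (r / 2); last first.
      by rewrite /u bx mulr0 scale0r scaler0 addr0.
    apply: (rc _ _).1; rewrite /u scalerA [x + _]addrC; apply: ball_move => //.
    have /andP[bx0 bx1] := b01 x; rewrite !mulr_ge0 ?(ltW e0)//=.
    by rewrite mulrCA ler_piMr ?(ltW e0)// mulr_ile1.
have push_lt q : dom c q -> b (chart_map c q) != 0 -> f (push c u 1 q) < f q.
  move=> cq; set x := chart_map c q => bq.
  have xr : `|x - x0| <= r / 2.
    by rewrite leNgt; apply/negP => /b0 bx; move: bq; rewrite bx eqxx.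
  have /andP[bx0 bx1] := b01 x.
  have bx : 0 < b x by rewrite lt_def bq.
  have line s : 0 <= s <= e * b x ->
      cod c (s *: w + x) /\ 'D_w F (s *: w + x) < 0.
    move=> /andP[s0 se]; apply/rc/ball_move => //; rewrite s0/=.
    by rewrite (le_trans se)// ler_piMr// ltW.
  have Dline s : 0 <= s <= e * b x ->
      is_derive s 1 (fun t => F (t *: w + x)) ('D_w F (s *: w + x)).
    by move=> /line[cs _]; apply: derive_line; exact: df.
  have fq : f q = F (0 *: w + x).
    by rewrite scale0r add0r /F/= /x chart_mapK ?inE.
  have fpq : f (push c u 1 q) = F ((e * b x) *: w + x).
    by rewrite push_in// scale1r addrC.
  rewrite fq fpq.
  have eb0 : 0 < e * b x by rewrite mulr_gt0.
  (* Mean value theorem along the displacement segment, which stays in that ball. *)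
  have [|||s] := @MVT_segment _ (fun t => F (t *: w + x))
    (fun s => 'D_w F (s *: w + x)) 0 (e * b x); rewrite ?(ltW eb0)//.
  - by move=> s; rewrite in_itv/= => /andP[s0 s1]; apply: Dline; rewrite !ltW.
  - apply: derivable_within_continuous => s; rewrite in_itv/= => /Dline.
    by move=> [].
  - rewrite in_itv/= => /line[_ Ds] E.
    by rewrite -subr_lt0 E subr0 nmulr_rlt0.
exists (push c u 1); first split => // q.
  have [cq|cq] := pselect (dom c q); last first.
    by right; rewrite /push; case: asboolP.
  have [bq|bq] := eqVneq (b (chart_map c q)) 0; last by left; exact: push_lt.
  by right; apply: push_id => //; rewrite /u bq mulr0 scale0r.
have : \forall q \near p, dom c q by exact: dom_nbhs.
have : \forall q \near p, b (chart_map c q) = 1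
    by exact: (chart_map_cont cp b1).
apply: filterS2 => q bq cq; apply: push_lt => //.
by rewrite bq oner_eq0.
Qed.

Lemma Ck_function_continuous : continuous f.
Proof.
move=> p; have [c ac cp] := atlas_cover p.
have [df _] := Cf ac.
apply: (@near_eq_continuous _ _ ((f \o chart_inv c) \o chart_map c)).
  have : \forall q \near p, dom c q by exact: dom_nbhs.
  by apply: filterS => q cq; rewrite /= chart_mapK ?inE.
apply: continuous_comp; first exact: chart_map_cont.
by apply: differentiable_continuous; apply: df; exact: chart_map_dom.
Qed.

Lemma descending_le h p : descending h -> f (h p) <= f p.
Proof. by move=> [_ /(_ p)[/ltW //|->]]. Qed.

Lemma descending_comp g h : descending g -> descending h -> descending (g \o h).
Proof.
move=> dg dh; split; first exact: homotopic_idfun_comp dg.1 dh.1.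
move=> p /=; case: (dh.2 p) => [hp|->]; last exact: dg.2.
by left; apply: le_lt_trans hp; exact: descending_le.
Qed.

Lemma descending_idfun : descending idfun.
Proof.
split; last by right.
exists (fun=> idfun); split => //.
- by apply: continuous_in_subspaceT => z _; exact: cvg_snd.
- move=> t _; split; first by move=> p; exact: cvg_id.
  move=> p c d ac ad cp dp; have [+ _] := atlas_smooth ac ad 1%N.
  by apply; exists p.
Qed.

(* [f (h p) < f p] survives composing [h] with any further descending map on
   either side, so the sets of descending maps improving on a given one form a
   filter base and the near-covering form of compactness applies. *)
Lemma descending_compact (K : set M) : compact K ->
  (forall p, K p -> ~ critical f p) ->
  exists2 h, descending h & forall p, K p -> f (h p) < f p.
Proof.
move=> /compact_near_coveringP cK nK.
pose up h0 :=
  [set h | descending h /\ forall p, f (h0 p) < f p -> f (h p) < f p].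
pose F := filter_from descending up.
have FF : Filter F.
  apply: filter_from_filter; first by exists idfun; exact: descending_idfun.
  move=> g h dg dh; exists (g \o h); first exact: descending_comp.
  move=> k [dk gh]; split; split => // p hp; apply: gh => /=.
    case: (dh.2 p) => [hp'|->//].
    by rewrite (le_lt_trans _ hp')// descending_le.
  by rewrite (le_lt_trans _ hp)// descending_le.
have [|h dh hK] := cK _ F (fun h p => f (h p) < f p) FF.
  move=> p /nK /descending_near[h dh hp].
  exists ([set q | f (h q) < f q], up h); first by split => //; exists h.
  by move=> [q k] [/= hq [_]]; exact.
(* [h] belongs to its own basic set [up h]. *)
by exists h => // p; exact: (hK h (conj dh (fun _ hp => hp))).
Qed.

(** The level minus [W] is compact without critical points, so one [h] descends strictly on it. Each
    point of [M] then admits all small [e] locally, and compactness of [M] makes [e] uniform. *)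
Lemma level_descent (a : R) (W : set M) : compact [set: M] -> open W ->
  (forall p, critical f p -> f p = a -> W p) ->
  exists2 h, descending h &
    \forall e \near 0^'+, forall p, f p <= a + e -> W p \/ f (h p) <= a - e.
Proof.
move=> cM oW aW.
have cf := Ck_function_continuous.
have cK : compact ([set p | f p = a] `&` ~` W).
  apply: (subclosed_compact _ cM) => //.
  apply: closedI; last exact: open_closedC.
  by apply: (@preimage_closed _ _ f [set a]) => //; move=> p _; exact: cf.
have [|h dh hK] := descending_compact cK.
  by move=> p [/= fa nW] cp; apply: nW; exact: aW.
exists h => //.
have ch p : {for p, continuous (f \o h)}.
  have [k [_ dk _ <-]] := dh.1.
  apply: continuous_comp; last exact: cf.
  by have [|+ _] := dk 1; [rewrite lexx ler01|exact].
have /compact_near_coveringP cov := cM.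
pose P e p := f p <= a + e -> W p \/ f (h p) <= a - e.
suff /cov : forall p, [set: M] p -> \forall q \near p & e \near 0^'+, P e q.
  by apply: filterS => e eP p; exact: eP.
move=> p _.
have near_hlt : f (h p) < a ->
    \forall q \near p & e \near 0^'+, P e q.
  (* Near [p], [f (h q)] stays below the midpoint of [f (h p)] and [a], and [e] is less than half
     the gap. *)
  move=> hpa; near=> q e => /= _; right.
  have : f (h q) < (f (h p) + a) / 2.
    by near: q; apply: cvgr_lt (ch p) _ _; rewrite /=; lra.
  have : e < (a - f (h p)) / 2 by near: e; apply: nbhs_right_lt; lra.
  lra.
have [pa|pa|pa] := ltgtP (f p) a.
- by apply: near_hlt; rewrite (le_lt_trans _ pa)// descending_le.
(* Above the level, the premise [f q <= a + e] fails near [p] for small [e]. *)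
- near=> q e => /= qe; exfalso.
  have : (f p + a) / 2 < f q by near: q; apply: cvgr_gt (cf p) _ _; lra.
  have : e < (f p - a) / 2 by near: e; apply: nbhs_right_lt; lra.
  lra.
- have [Wp|nWp] := pselect (W p); last first.
    by apply: near_hlt; rewrite -pa; exact: hK.
  by near=> q e => /= _; left; near: q; exact: open_nbhs_nbhs.
Unshelve. all: by end_near. Qed.

(** * Covers of sublevel sets indexed by critical points *)

Definition critical_cover (a : R) := exists U : M -> set M,
  (forall p, open (U p) /\ ambient_nullhomotopic (U p)) /\
  forall q, f q <= a -> exists p, [/\ critical f p, f p <= a & U p q].

(** If [g] collapses [A], then [g \o h] collapses the preimage, and the homotopies compose. *)
Lemma ambient_nullhomotopic_preimage h (A : set M) :
  homotopic_through_differentiable idfun h ->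
  ambient_nullhomotopic A -> ambient_nullhomotopic (h @^-1` A).
Proof.
move=> hom [g [dg homg [m gA]]]; exists (g \o h); split.
- apply: differentiable_map_comp => //.
  by have [k [_ dk _ <-]] := hom; apply: dk; rewrite lexx ler01.
- exact: homotopic_idfun_comp.
- by exists m => q; exact: gA.
Qed.

Lemma critical_cover_all a : compact [set: M] -> critical_cover a.
Proof.
move=> cM; have cf := Ck_function_continuous.
have [W WP] := choice ambient_nullhomotopic_nbhs.
have step b : \forall e \near 0^'+, critical_cover (b - e) ->
    forall y, b <= y <= b + e -> critical_cover y.
  pose V := \bigcup_(p in [set p | critical f p /\ f p = b]) W p.
  have [||h dh] := @level_descent b V cM.
  - by apply: bigcup_open => p _; case: (WP p).
  - by move=> p cp fp; exists p => //; case: (WP p).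
  apply: filterS2 (nbhs_right_gt 0) => e e0 eV [U [UP Ucov]] y /andP[b_le_y ye].
  (* Critical points at level [b] fall under [else] because [e > 0], so old and new members never
     compete for an index. *)
  exists (fun p => if f p <= b - e then h @^-1` U p else W p); split.
    move=> p; case: ifP => _; last by case: (WP p).
    have [oU nU] := UP p; split;
      last exact: ambient_nullhomotopic_preimage dh.1 nU.
    apply: open_comp => // q _; have [k [_ dk _ <-]] := dh.1.
    by have [|+ _] := dk 1; [rewrite lexx ler01|exact].
  move=> q qy; have [|[p [cp fp] Wq]|/Ucov[p [cp fp Uq]]] := eV q.
  - exact: le_trans qy ye.
  - by exists p; rewrite fp; split => //; rewrite lerBrDr gerDl leNgt e0.
  - by exists p; rewrite fp; split => //; lra.
apply: contrapT => na.
pose B := [set b | ~ critical_cover b].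
have [[q _]|M0] := pselect (exists q : M, True); last first.
  apply: na; exists W; split; first by move=> p; case: (WP p).
  by move=> q; case: M0; exists q.
have [p0 _ p0min] : exists2 p0, p0 \in [set: M] &
    forall q, q \in [set: M] -> f p0 <= f q.
  by apply: compact_EVT_min => //; [exists q|exact: continuous_subspaceT].
(* Below the minimum of [f] the sublevel set is empty, so any admissible family covers it. *)
have lB : lbound B (f p0).
  move=> b /= nb; rewrite leNgt; apply/negP => bp0; apply: nb.
  exists W; split; first by move=> p; case: (WP p).
  by move=> p pb; have := p0min p; rewrite inE => /(_ I); lra.
have infB : has_inf B by split; [exists a|exists (f p0)].
have /filter_ex [e [e0 stepe]] : \forall e \near 0^'+, 0 < e /\
    (critical_cover (inf B - e) ->
      forall y, inf B <= y <= inf B + e -> critical_cover y).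
  by near=> e; split; near: e; [exact: nbhs_right_gt|exact: step].
have cov b : b < inf B -> critical_cover b.
  move=> binf; apply: contrapT => nb.
  by have := @ge_inf _ B (ex_intro _ _ lB) b nb; lra.
(* An uncovered level within [e] above the infimum contradicts [stepe], as [inf B - e] is
   covered. *)
have [b nb be] := inf_adherent e0 infB.
apply: (nb); apply: stepe; first by apply: cov; lra.
by rewrite (ltW be) andbT; apply: ge_inf => //; exists (f p0).
Unshelve. all: by end_near. Qed.

End Descent.

End Deformation.

(** * From covers to the count of critical points *)

Lemma Ck_function_pred (R : realType) (n : nat) (M : manifold R n) (k : nat)
    (f : M -> R) : Ck_function k.+1 f -> Ck_function k f.
Proof.
move=> Cf c /Cf {Cf}; elim: k (f \o chart_inv c) => [|k IH] g [dg Dg].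
  by move=> x /dg /differentiable_continuous.
by split=> // v; apply: IH; exact: Dg.
Qed.

Lemma cat_a_le (R : realType) (n : nat) (M : manifold R n) (l : nat) :
  ambient_cover M l -> (cat_a M <= l%:R%:E)%E.
Proof.
move=> Ml; rewrite /cat_a; case: pselect => [e|]; last first.
  by case; exists l; exact/asboolP.
by case: ex_minnP => m _ mmin; rewrite lee_fin ler_nat; apply/mmin/asboolP.
Qed.

Lemma ambient_cover_seq (R : realType) (n : nat) (M : manifold R n)
    (s : seq M) (U : M -> set M) :
  (forall p, open (U p) /\ ambient_nullhomotopic (U p)) ->
  (forall q, exists2 p, p \in s & U p q) -> ambient_cover M (size s).
Proof.
move=> UP Us; exists (fun i => U (tnth (in_tuple s) i)); split => //.
rewrite -subTset => q _; have [p /seq_tnthP[i ->] Uq] := Us q.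
by exists i.
Qed.

Theorem theorem3p5 (R : realType) (n : nat) (M : manifold R n) (f : M -> R) :
  closed_manifold M -> Ck_function 2 f ->
  (cat_a M <= counting (Crit f))%E.
Proof.
move=> cM /Ck_function_pred Cf; rewrite /counting.
case: asboolP => [finC|_]; last exact: leey.
(* At an upper bound of [f] the sublevel set is all of [M]; for empty [M] any level serves. *)
have [a fa] : exists a, forall q, f q <= a.
  have [[q _]|M0] := pselect (exists q : M, True); last first.
    by exists 0 => q; case: M0; exists q.
  have [||p _ pmax] := @compact_EVT_max _ _ f _ _ cM; first by exists q.
    by apply: continuous_subspaceT; exact: Ck_function_continuous.
  by exists (f p) => x; apply: pmax; rewrite inE.
have [U [UP Ucov]] := critical_cover_all Cf a cM.
apply/cat_a_le/(ambient_cover_seq UP) => q.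
have [p [cp _ Uq]] := Ucov q (fa q).
by exists p => //; rewrite in_fset_set// inE.
Qed.
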